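(* Let $G=H\rtimes\mathbb{Z}^n$ and let $\rho\colon\mathbb{Z}^n\to\mathbb{R}$ be a character. The poset $\mathrm{Conf}^*_\rho(G)$ is a join semilattice. Given $\rho$-confining subsets $Q_1,Q_2\subseteq H$, the join of $[Q_1]$ and $[Q_2]$ is $[Q_1\cap Q_2]$.
   Context: Semidirect products are internal, and $x^y=y^{-1}xy$. A character is a homomorphism to $\mathbb{R}$. A subset $Q\subseteq H$ is $\rho$-confining if $Q=Q^{-1}$ and: $Q^z\subseteq Q$ for all $z\in\mathbb{Z}^n$ with $\rho(z)\ge0$; for every $h\in H$ there is $z\in\mathbb{Z}^n$ with $h^z\in Q$; and there is $z_0\in\mathbb{Z}^n$ with $(Q\cdot Q)^{z_0}\subseteq Q$. It is strictly $\rho$-confining if moreover $Q^z\subsetneq Q$ for some $z\in\mathbb{Z}^n$. For non-trivial $\rho$, fix a finite generating set $\{a_1,\dots,a_n\}$ of $\mathbb{Z}^n$ and a constant $C_\rho>0$ with $|\rho(a_i)|\le C_\rho$ for all $i$ and such that $C_\rho=\rho(z_{top})$ for some $z_{top}\in\mathbb{Z}^n$; set $Z_\rho=\{z\in\mathbb{Z}^n:|\rho(z)|\le C_\rho\}$ (for $\rho=0$, $Z_\rho=\mathbb{Z}^n$). For $\rho$-confining $Q$, $Q\cup Z_\rho$ generates $G$. Write $Q_1\preceq_\rho Q_2$ if the elements of $Q_2$ have uniformly bounded word length with respect to $Q_1\cup Z_\rho$. This is a preorder; $\mathrm{Conf}_\rho(G)$ denotes the induced poset of equivalence classes $[Q]$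 of $\rho$-confining subsets, with order $\preccurlyeq_\rho$, and $\mathrm{Conf}^*_\rho(G)$ the subposet of classes of strictly $\rho$-confining subsets. The join of two elements of a poset is their least upper bound; a poset is a join semilattice if every two elements have a join. *)

(* Defs.v *)
From HB Require Import structures.
From mathcomp Require Import all_boot all_order all_algebra.
From mathcomp Require Import all_classical reals.
Set Implicit Arguments.
Unset Strict Implicit.
Unset Printing Implicit Defensive.
Import Order.TTheory GRing.Theory Num.Theory.
Local Open Scope quotient_scope.
Local Open Scope classical_set_scope.
Local Open Scope ring_scope.

(* [t] identifies 'rV[int]_n (i.e. Z^n, written additively) with a complement
   of H in G; everything below conjugates by [t z]. *)
Record semidirect (G : groupType) (n : nat) (H : set G)
    (t : 'rV[int]_n -> G) : Prop := Semidirect {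
  semi_one : H 1%g;
  semi_mul : forall x y, H x -> H y -> H (x * y)%g;
  semi_inv : forall x, H x -> H (x^-1)%g;
  semi_normal : forall x g, H x -> H (x ^ g)%g;
  semi_morph : forall z w, t (z + w) = (t z * t w)%g;
  semi_inj : injective t;
  semi_disj : H `&` range t = [set 1%g];
  semi_full : [set (h * a)%g | h in H & a in range t] = [set: G]
}.

Definition nontrivial (n : nat) (R : realType)
    (rho : {additive 'rV[int]_n -> R}) : Prop := exists z, rho z != 0.

(* The auxiliary choices (a_i), C_rho made when rho is non-trivial. *)
Record admissible (n : nat) (R : realType) (rho : {additive 'rV[int]_n -> R})
    (a : 'I_n -> 'rV[int]_n) (C : R) : Prop := Admissible {
  adm_gen : forall z, exists c : 'I_n -> int, z = \sum_i a i *~ c i;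
  adm_pos : 0 < C;
  adm_le : forall i, `|rho (a i)| <= C;
  adm_top : exists ztop, rho ztop = C
}.

(* The whole of Z^n when rho = 0. *)
Definition Zrho (n : nat) (R : realType) (rho : {additive 'rV[int]_n -> R})
    (C : R) : set 'rV[int]_n :=
  [set z | nontrivial rho -> `|rho z| <= C].

Definition conjset (G : groupType) (n : nat) (t : 'rV[int]_n -> G)
    (Q : set G) (z : 'rV[int]_n) : set G := [set (q ^ t z)%g | q in Q].

Record confining (G : groupType) (n : nat) (H : set G)
    (t : 'rV[int]_n -> G) (R : realType) (rho : {additive 'rV[int]_n -> R})
    (Q : set G) : Prop := Confining {
  conf_sub : Q `<=` H;
  conf_sym : Q = [set (q^-1)%g | q in Q];
  conf_stable : forall z, 0 <= rho z -> conjset t Q z `<=` Q;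
  conf_absorb : forall h, H h -> exists z, Q (h ^ t z)%g;
  conf_mul : exists z0, conjset t [set (x * y)%g | x in Q & y in Q] z0 `<=` Q
}.

Definition strictly_confining (G : groupType) (n : nat) (H : set G)
    (t : 'rV[int]_n -> G) (R : realType) (rho : {additive 'rV[int]_n -> R})
    (Q : set G) : Prop :=
  confining H t rho Q /\ exists z, conjset t Q z `<` Q.

(* The word length of g with respect to S is at most k. *)
Definition word_length_le (G : groupType) (S : set G) (k : nat) (g : G) : Prop :=
  exists2 s : seq G, (size s <= k)%N &
    (forall x, x \in s -> S x \/ S (x^-1)%g) /\ g = (\big[*%g/1%g]_(x <- s) x).

(* Larger sets are smaller for this preorder. *)
Definition preceq (G : groupType) (n : nat) (t : 'rV[int]_n -> G)
    (R : realType) (rho : {additive 'rV[int]_n -> R}) (C : R)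
    (Q1 Q2 : set G) : Prop :=
  exists k, forall g, Q2 g -> word_length_le (Q1 `|` t @` Zrho rho C) k g.

Lemma preceq_refl (G : groupType) (n : nat) (t : 'rV[int]_n -> G)
    (R : realType) (rho : {additive 'rV[int]_n -> R}) (C : R) (Q : set G) :
  preceq t rho C Q Q.
Proof.
exists 1%N => g Qg; exists [:: g] => //; split; last by rewrite big_seq1.
by move=> x; rewrite inE => /eqP ->; left; left.
Qed.

Lemma word_length_le_prod (G : groupType) (S : set G) (k : nat) (s : seq G) :
  (forall x, x \in s -> word_length_le S k x) ->
  word_length_le S (size s * k) (\big[*%g/1%g]_(x <- s) x).
Proof.
elim: s => [|x s IHs] hs.
  by exists [::] => //; split; rewrite ?big_nil.
have [u su [uS xE]] := hs x (mem_head _ _).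
have [|v sv [vS sE]] := IHs; first by move=> y ys; apply: hs; rewrite inE ys orbT.
exists (u ++ v); first by rewrite size_cat mulSn leq_add.
split; last by rewrite big_cons big_cat -xE -sE.
by move=> y; rewrite mem_cat => /orP[]; [apply: uS | apply: vS].
Qed.

Lemma word_length_leW (G : groupType) (S : set G) (k l : nat) (g : G) :
  (k <= l)%N -> word_length_le S k g -> word_length_le S l g.
Proof. by move=> kl [s sk ?]; exists s => //; apply: leq_trans kl. Qed.

Lemma word_length_leV (G : groupType) (S : set G) (k : nat) (g : G) :
  word_length_le S k g -> word_length_le S k (g^-1)%g.
Proof.
move=> [s sk [sS ->]]; exists (rev [seq (x^-1)%g | x <- s]).
  by rewrite size_rev size_map.
split; last by rewrite -map_rev big_map prodgV revK.
move=> x; rewrite mem_rev => /mapP[y /sS yS ->].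
by rewrite invgK; case: yS; [right | left].
Qed.

Lemma preceq_trans (G : groupType) (n : nat) (t : 'rV[int]_n -> G)
    (R : realType) (rho : {additive 'rV[int]_n -> R}) (C : R)
    (Q1 Q2 Q3 : set G) :
  preceq t rho C Q1 Q2 -> preceq t rho C Q2 Q3 -> preceq t rho C Q1 Q3.
Proof.
move=> [k h12] [l h23]; exists (l * k.+1)%N => g /h23[s sl [sS ->]].
apply: (@word_length_leW _ _ (size s * k.+1)); first by rewrite leq_mul2r sl orbT.
apply: word_length_le_prod => x xs.
have gen y : (Q2 `|` t @` Zrho rho C) y ->
    word_length_le (Q1 `|` t @` Zrho rho C) k.+1 y.
  case=> [/h12|Zy]; first exact: word_length_leW.
  exists [:: y] => //; split; last by rewrite big_seq1.
  by move=> w; rewrite inE => /eqP ->; left; right.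
by have [/gen//|/gen/word_length_leV] := sS x xs; rewrite invgK.
Qed.

Record confining_set (G : groupType) (n : nat) (H : set G)
    (t : 'rV[int]_n -> G) (R : realType) (rho : {additive 'rV[int]_n -> R}) :=
  ConfiningSet {
    confining_carrier :> set G;
    _ : `[< confining H t rho confining_carrier >]
  }.

HB.instance Definition _ (G : groupType) (n : nat) (H : set G)
    (t : 'rV[int]_n -> G) (R : realType) (rho : {additive 'rV[int]_n -> R}) :=
  [isSub for @confining_carrier G n H t R rho].
HB.instance Definition _ (G : groupType) (n : nat) (H : set G)
    (t : 'rV[int]_n -> G) (R : realType) (rho : {additive 'rV[int]_n -> R}) :=
  [Choice of confining_set H t rho by <:].

Lemma confining_setP (G : groupType) (n : nat) (H : set G)
    (t : 'rV[int]_n -> G) (R : realType) (rho : {additive 'rV[int]_n -> R})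
    (Q : confining_set H t rho) : confining H t rho Q.
Proof. by case: Q => Q /= /asboolP. Qed.

Definition conf_equiv (G : groupType) (n : nat) (H : set G)
    (t : 'rV[int]_n -> G) (R : realType) (rho : {additive 'rV[int]_n -> R})
    (C : R) : rel (confining_set H t rho) :=
  fun Q1 Q2 => `[< preceq t rho C Q1 Q2 /\ preceq t rho C Q2 Q1 >].

Lemma conf_equiv_refl (G : groupType) (n : nat) (H : set G)
    (t : 'rV[int]_n -> G) (R : realType) (rho : {additive 'rV[int]_n -> R})
    (C : R) : reflexive (@conf_equiv G n H t R rho C).
Proof. by move=> Q; apply/asboolP; split; apply: preceq_refl. Qed.

Lemma conf_equiv_sym (G : groupType) (n : nat) (H : set G)
    (t : 'rV[int]_n -> G) (R : realType) (rho : {additive 'rV[int]_n -> R})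
    (C : R) : symmetric (@conf_equiv G n H t R rho C).
Proof. by move=> Q1 Q2; apply/asboolP/asboolP => -[]. Qed.

Lemma conf_equiv_trans (G : groupType) (n : nat) (H : set G)
    (t : 'rV[int]_n -> G) (R : realType) (rho : {additive 'rV[int]_n -> R})
    (C : R) : transitive (@conf_equiv G n H t R rho C).
Proof.
move=> Q2 Q1 Q3 /asboolP[h12 h21] /asboolP[h23 h32].
by apply/asboolP; split; [apply: preceq_trans h12 h23 | apply: preceq_trans h32 h21].
Qed.

Canonical conf_equiv_rel (G : groupType) (n : nat) (H : set G)
    (t : 'rV[int]_n -> G) (R : realType) (rho : {additive 'rV[int]_n -> R})
    (C : R) : equiv_rel (confining_set H t rho) :=
  EquivRel (@conf_equiv G n H t R rho C)
    (@conf_equiv_refl G n H t R rho C) (@conf_equiv_sym G n H t R rho C)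
    (@conf_equiv_trans G n H t R rho C).

Definition Conf (G : groupType) (n : nat) (H : set G)
    (t : 'rV[int]_n -> G) (R : realType) (rho : {additive 'rV[int]_n -> R})
    (C : R) : Type := {eq_quot @conf_equiv_rel G n H t R rho C}.

HB.instance Definition _ (G : groupType) (n : nat) (H : set G)
    (t : 'rV[int]_n -> G) (R : realType) (rho : {additive 'rV[int]_n -> R})
    (C : R) := EqQuotient.copy (Conf H t rho C)
  {eq_quot @conf_equiv_rel G n H t R rho C}.
HB.instance Definition _ (G : groupType) (n : nat) (H : set G)
    (t : 'rV[int]_n -> G) (R : realType) (rho : {additive 'rV[int]_n -> R})
    (C : R) := Choice.copy (Conf H t rho C)
  {eq_quot @conf_equiv_rel G n H t R rho C}.

Definition conf_class (G : groupType) (n : nat) (H : set G)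
    (t : 'rV[int]_n -> G) (R : realType) (rho : {additive 'rV[int]_n -> R})
    (C : R) (Q : confining_set H t rho) : Conf H t rho C :=
  \pi_(Conf H t rho C) Q.

(* Independent of the representatives, see conf_classP. *)
Definition conf_le (G : groupType) (n : nat) (H : set G)
    (t : 'rV[int]_n -> G) (R : realType) (rho : {additive 'rV[int]_n -> R})
    (C : R) : rel (Conf H t rho C) :=
  fun x y => `[< preceq t rho C (repr x) (repr y) >].

Lemma conf_le_refl (G : groupType) (n : nat) (H : set G)
    (t : 'rV[int]_n -> G) (R : realType) (rho : {additive 'rV[int]_n -> R})
    (C : R) : reflexive (@conf_le G n H t R rho C).
Proof. by move=> x; apply/asboolP; apply: preceq_refl. Qed.

Lemma conf_le_anti (G : groupType) (n : nat) (H : set G)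
    (t : 'rV[int]_n -> G) (R : realType) (rho : {additive 'rV[int]_n -> R})
    (C : R) : antisymmetric (@conf_le G n H t R rho C).
Proof.
move=> x y /andP[/asboolP xy /asboolP yx].
by rewrite -[x]reprK -[y]reprK; apply/eqmodP; apply/asboolP.
Qed.

Lemma conf_le_trans (G : groupType) (n : nat) (H : set G)
    (t : 'rV[int]_n -> G) (R : realType) (rho : {additive 'rV[int]_n -> R})
    (C : R) : transitive (@conf_le G n H t R rho C).
Proof.
by move=> y x z /asboolP xy /asboolP yz; apply/asboolP; apply: preceq_trans xy yz.
Qed.

Fact conf_display : Order.disp_t. Proof. exact: (Order.Disp tt tt). Qed.

HB.instance Definition _ (G : groupType) (n : nat) (H : set G)
    (t : 'rV[int]_n -> G) (R : realType) (rho : {additive 'rV[int]_n -> R})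
    (C : R) := Order.Le_isPOrder.Build conf_display (Conf H t rho C)
  (@conf_le_refl G n H t R rho C) (@conf_le_anti G n H t R rho C)
  (@conf_le_trans G n H t R rho C).

Lemma conf_classP (G : groupType) (n : nat) (H : set G)
    (t : 'rV[int]_n -> G) (R : realType) (rho : {additive 'rV[int]_n -> R})
    (C : R) (Q1 Q2 : confining_set H t rho) :
  (conf_class C Q1 <= conf_class C Q2)%O <-> preceq t rho C Q1 Q2.
Proof.
have reprE (Q : confining_set H t rho) : conf_equiv C (repr (conf_class C Q)) Q.
  have /eqmodP// : repr (conf_class C Q) = Q %[mod_eq @conf_equiv_rel G n H t R rho C].
  exact: reprK.
have /asboolP[h1 h1'] := reprE Q1; have /asboolP[h2 h2'] := reprE Q2.
split=> [/asboolP h|h].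
  by apply: preceq_trans (preceq_trans h h2); apply: h1'.
by apply/asboolP; apply: preceq_trans (preceq_trans h h2'); apply: h1.
Qed.

Record ConfStar (G : groupType) (n : nat) (H : set G)
    (t : 'rV[int]_n -> G) (R : realType) (rho : {additive 'rV[int]_n -> R})
    (C : R) := ConfStarMk {
  star_class :> Conf H t rho C;
  _ : `[< exists2 Q : confining_set H t rho,
          strictly_confining H t rho Q & star_class = conf_class C Q >]
}.

HB.instance Definition _ (G : groupType) (n : nat) (H : set G)
    (t : 'rV[int]_n -> G) (R : realType) (rho : {additive 'rV[int]_n -> R})
    (C : R) := [isSub for @star_class G n H t R rho C].
HB.instance Definition _ (G : groupType) (n : nat) (H : set G)
    (t : 'rV[int]_n -> G) (R : realType) (rho : {additive 'rV[int]_n -> R})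
    (C : R) := [Choice of ConfStar H t rho C by <:].
HB.instance Definition _ (G : groupType) (n : nat) (H : set G)
    (t : 'rV[int]_n -> G) (R : realType) (rho : {additive 'rV[int]_n -> R})
    (C : R) := [SubChoice_isSubPOrder of ConfStar H t rho C by <: with conf_display].

Definition is_join (d : Order.disp_t) (P : porderType d) (x y z : P) : Prop :=
  supremums [set x; y] z.

Definition is_join_semilattice (d : Order.disp_t) (P : porderType d) : Prop :=
  forall x y : P, exists z, is_join x y z.

(* Main.v *)
Require Import Defs.
From HB Require Import structures.
From mathcomp Require Import all_boot all_order all_algebra.
From mathcomp Require Import all_classical reals.
Local Open Scope classical_set_scope.

(** The word-metric preorder on confining subsets is inclusion up to conjugation
by the complement: [Q] precedes [Q'] exactly when some [z] satisfies
[conjset t Q' z `<=` Q] ([preceqP]).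

If the elements of [Q'] have words of bounded length over [Q] and [Zrho], move
all letters of [Zrho] in such a word to the right ([word_normal_form]). An
element of [H] then becomes a product of boundedly many conjugates of elements
of [Q] by complement elements on which [rho] is bounded, because the complement
part it leaves behind is trivial. Conjugating by one [t z] with [rho z] large
puts all these factors in [Q]; multiplying them out inside [Q] only asks for
[rho z] to be larger by a multiple of [rho z0], where conjugation by [t z0]
brings products of two elements of [Q] back to [Q]. Conversely, a conjugating element [t z] has some
finite length over [Zrho], so undoing the conjugation lengthens words by a
constant.

Stability of [Q] makes membership of [h ^ t z] in [Q] monotone in [rho z]
([confining_conj_le]). So when two confining subsets satisfy a requirement for
some [z1] and [z2], one with the larger value of [rho] works for both. This
shows that [Q1 `&` Q2] is confining ([confiningI]), and, through [preceqP], that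
it precedes everything that [Q1] and [Q2] both precede ([preceqI]); hence its
class is the join ([conf_class_join]).

A confining subset is strictly confining exactly when it is not all of [H]
([strictly_confiningP]). Intersections inherit this, so joins of classes of
strictly confining subsets stay in [ConfStar] ([conf_star_join]). *)

(** * Word length *)

Section WordLength.
Set Implicit Arguments.
Unset Strict Implicit.
Unset Printing Implicit Defensive.
Local Open Scope group_scope.

Context (G : groupType).
Implicit Types (S : set G) (g h : G).

Lemma word_length_le1 S g : S g -> word_length_le S 1 g.
Proof.
by move=> Sg; exists [:: g] => //; split=> [x|]; rewrite ?big_seq1// inE => /eqP ->; left.
Qed.

Lemma word_length_leM S k l g h :
  word_length_le S k g -> word_length_le S l h -> word_length_le S (k + l) (g * h).
Proof.
move=> [s sk [sS ->]] [u ul [uS ->]].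
exists (s ++ u); first by rewrite size_cat leq_add.
by rewrite big_cat; split=> // x; rewrite mem_cat => /orP[/sS|/uS].
Qed.

Lemma word_length_le_mono (S T : set G) k g :
  S `<=` T -> word_length_le S k g -> word_length_le T k g.
Proof.
by move=> ST [s sk [sS ->]]; exists s => //; split=> // x /sS[]/ST; [left | right].
Qed.

End WordLength.

(** * Conjugation by the complement *)

Section Confining.
Set Implicit Arguments.
Unset Strict Implicit.
Unset Printing Implicit Defensive.
Import Order.TTheory GRing.Theory Num.Theory.
Local Open Scope ring_scope.

Context (G : groupType) (n : nat) (H : set G) (t : 'rV[int]_n -> G).
Context (R : realType) (rho : {additive 'rV[int]_n -> R}).
Context (hG : semidirect H t).
Implicit Types (z w : 'rV[int]_n) (Q : set G).

Lemma complementD z w : t (z + w) = (t z * t w)%g.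
Proof. exact: semi_morph hG z w. Qed.

Lemma complement0 : t 0 = 1%g.
Proof. by apply: (mulgI (t 0)); rewrite -complementD addr0 mulg1. Qed.

Lemma complementN z : t (- z) = ((t z)^-1)%g.
Proof.
by apply: (mulgI (t z)); rewrite -complementD subrr complement0 mulgV.
Qed.

Lemma conjg_complementD g z w : (g ^ t (z + w) = (g ^ t z) ^ t w)%g.
Proof. by rewrite complementD conjgM. Qed.

Lemma confining_conj Q q z :
  confining H t rho Q -> Q q -> 0 <= rho z -> Q (q ^ t z)%g.
Proof. by move=> cQ Qq z0; apply: (conf_stable cQ z0); exists q. Qed.

(** Deeper conjugates land in [Q] as soon as one conjugate does, so that only
the value of [rho] on the conjugating element matters. *)
Lemma confining_conj_le Q h z w :
  confining H t rho Q -> Q (h ^ t z)%g -> rho z <= rho w -> Q (h ^ t w)%g.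
Proof.
move=> cQ Qh zw; rewrite -[w](subrKC z) conjg_complementD.
by apply: confining_conj => //; rewrite raddfB subr_ge0.
Qed.

Lemma confiningV Q q : confining H t rho Q -> Q (q^-1)%g -> Q q.
Proof. by move=> cQ Qq; rewrite (conf_sym cQ); exists (q^-1)%g; rewrite ?invgK. Qed.

Lemma confining1 Q : confining H t rho Q -> Q 1%g.
Proof.
by move=> cQ; have [z] := conf_absorb cQ (semi_one hG); rewrite conj1g.
Qed.

(** When the [z0] of the definition has [rho z0 < 0], the product [Q * Q] is
already inside [Q], and [0] serves instead. *)
Lemma confining_mul_ge0 Q : confining H t rho Q ->
  exists2 z0, 0 <= rho z0 & forall x y, Q x -> Q y -> Q ((x * y) ^ t z0)%g.
Proof.
move=> cQ; have [z0 mulQ] := conf_mul cQ.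
have Qz0 x y : Q x -> Q y -> Q ((x * y) ^ t z0)%g.
  by move=> Qx Qy; apply: mulQ; exists (x * y)%g => //; exists x => //; exists y.
have [z0ge|/ltW z0le] := leP 0 (rho z0); first by exists z0.
exists 0; first by rewrite raddf0.
by move=> x y Qx Qy; apply: confining_conj_le (Qz0 x y Qx Qy) _; rewrite // raddf0.
Qed.

(** * The preorder as inclusion up to conjugation *)

(** Pushing every letter of [t @` Zrho rho C] to the right end of a word
conjugates the letters taken from [Q] by elements on which [rho] is bounded in
terms of the length of the word; conjugating far enough puts their product in
[Q]. The budget per letter is [D], for moving past a letter of the complement, plus
[rho z0], for merging two elements of [Q]. *)
Lemma word_normal_form Q C (D : R) z0 k g :
    confining H t rho Q ->
    0 <= D -> (forall z, Zrho rho C z -> `|rho z| <= D) ->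
    0 <= rho z0 -> (forall x y, Q x -> Q y -> Q ((x * y) ^ t z0)%g) ->
    word_length_le (Q `|` t @` Zrho rho C) k g ->
  exists w, forall z, (D + rho z0) *+ k <= rho z -> Q ((g * (t w)^-1) ^ t z)%g.
Proof.
move=> cQ D0 leD z0_ge0 mulQ [s sk [sS gE]].
suff [w Qw] : exists w, forall z,
    (D + rho z0) *+ size s <= rho z -> Q ((g * (t w)^-1) ^ t z)%g.
  exists w => z kz; apply: Qw; apply: le_trans kz.
  by rewrite ler_wpMn2l// addr_ge0.
rewrite {g sk}gE; elim: s sS => [|x s IHs] sS.
  exists 0 => z _; rewrite big_nil complement0 invg1 mulg1 conj1g.
  exact: confining1 cQ.
have [|w Qw] := IHs; first by move=> y ys; apply: sS; rewrite inE ys orbT.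
rewrite big_cons; set g := (\big[_/_]_(y <- s) y)%g in Qw *.
have {sS} : Q x \/ exists2 v, `|rho v| <= D & x = t v.
  have [[Qx|[v Zv vx]]|[Qx|[v Zv vx]]] := sS x (mem_head _ _).
  - by left.
  - by right; exists v; rewrite ?leD.
  - by left; apply: confiningV Qx.
  - by right; exists (- v); rewrite ?raddfN ?normrN ?leD// complementN vx invgK.
case=> [Qx|[v vD ->]].
  exists w => z /=; rewrite mulrSr => zge.
  have zz0 : (D + rho z0) *+ size s <= rho (z - z0).
    by rewrite raddfB lerBrDr; apply: le_trans zge; rewrite lerD2l lerDr.
  have zz0_ge0 : 0 <= rho (z - z0).
    by apply: le_trans zz0; rewrite mulrn_wge0// addr_ge0.
  rewrite -[z](subrK z0) conjg_complementD -mulgA (conjMg x).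
  by apply: mulQ; [apply: confining_conj | apply: Qw].
exists (v + w) => z /=; rewrite mulrSr => zge.
have -> : ((t v * g * (t (v + w))^-1) ^ t z = (g * (t w)^-1) ^ t (- v + z))%g.
  rewrite conjg_complementD complementN; congr (_ ^ _)%g.
  by rewrite complementD invgM conjgE invgK !mulgA.
apply: Qw; rewrite raddfD raddfN -lerBlDl opprK; apply: le_trans zge.
by rewrite lerD2l (le_trans (ler_norm _))// (le_trans vD)// lerDl.
Qed.

Context (a : 'I_n -> 'rV[int]_n) (C : R).
Context (hC : nontrivial rho -> admissible rho a C).

(** The bound has to be a value of [rho], so that multiples of [ztop] conjugate
as deeply as [word_normal_form] asks; it is [C], or [0] if [rho] is trivial. *)
Lemma Zrho_bound : exists ztop, 0 <= rho ztop /\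
  forall z, Zrho rho C z -> `|rho z| <= rho ztop.
Proof.
have [nt|triv] := pselect (nontrivial rho).
  have [_ C0 _ [ztop topC]] := hC nt.
  by exists ztop; rewrite topC (ltW C0); split=> // z; apply.
exists 0; rewrite raddf0; split=> // z _.
have [->|rz] := eqVneq (rho z) 0; first by rewrite normr0.
by case: triv; exists z.
Qed.

(** Each [t z] has finite length over [t @` Zrho rho C], because this set
contains the generators [t (a i)], or the whole complement if [rho] is
trivial. *)
Lemma complement_word_length z :
  exists k, word_length_le (t @` Zrho rho C) k (t z).
Proof.
have [nt|triv] := pselect (nontrivial rho); last first.
  by exists 1%N; apply: word_length_le1; exists z => // /triv.
have [gen C0 aC _] := hC nt.
pose P z := exists k, word_length_le (t @` Zrho rho C) k (t z).
have P0 : P 0.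
  by exists 0%N; exists [::] => //; rewrite big_nil complement0.
have PD x y : P x -> P y -> P (x + y).
  by move=> [k kx] [l ly]; exists (k + l)%N; rewrite complementD; apply: word_length_leM.
have PN x : P x -> P (- x).
  by move=> [k kx]; exists k; rewrite complementN; apply: word_length_leV.
have Pn i m : P (a i *+ m).
  elim: m => [|m IHm]; rewrite ?mulr0n// mulrS; apply: PD => //.
  by exists 1%N; apply: word_length_le1; exists (a i) => // _; apply: aC.
have [c ->] := gen z; elim/big_ind: _ => // i _.
by case: (c i) => m; rewrite ?NegzE ?mulrNz; [apply: Pn | apply/PN/Pn].
Qed.

(** From left to right, the bound on word length in [Q'] gives one [z] for all
its elements; from right to left, [g] is [g ^ t z] with a word for [t z] on each
side. *)
Lemma preceqP Q Q' : confining H t rho Q -> Q' `<=` H ->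
  preceq t rho C Q Q' <-> exists z, conjset t Q' z `<=` Q.
Proof.
move=> cQ sQ'H; split=> [[k kQ']|[z zQ']].
  have [z0 z0_ge0 mulQ] := confining_mul_ge0 cQ.
  have [ztop [top_ge0 leD]] := Zrho_bound.
  exists ((ztop + z0) *+ k) => _ [g Q'g <-].
  have [w Qw] := word_normal_form cQ top_ge0 leD z0_ge0 mulQ (kQ' g Q'g).
  have {Qw}Qz : Q ((g * (t w)^-1) ^ t ((ztop + z0) *+ k))%g.
    by apply: Qw; rewrite raddfMn raddfD.
  have tw1 : t w = 1%g.
    (* [g] and [g * (t w)^-1] both lie in [H], hence so does [t w]. *)
    suff : (H `&` range t) (t w) by rewrite (semi_disj hG).
    split; last by exists w.
    have := semi_normal hG ((t ((ztop + z0) *+ k))^-1)%g (conf_sub cQ Qz).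
    rewrite conjgK => /(semi_inv hG); rewrite invgM invgK => Hg.
    by rewrite -(mulgVK g (t w)); apply: semi_mul hG _ _ _ (sQ'H _ Q'g).
  by move: Qz; rewrite tw1 invg1 mulg1.
have [l lz] := complement_word_length z.
exists (l + (1 + l))%N => g Q'g.
have -> : (g = t z * (g ^ t z * (t z)^-1))%g.
  by rewrite conjgE !mulgA mulgV mul1g mulgK.
have lz' : word_length_le (Q `|` t @` Zrho rho C) l (t z).
  by apply: word_length_le_mono lz; apply: subsetUr.
apply: word_length_leM => //; apply: word_length_leM; last exact: word_length_leV.
by apply: word_length_le1; left; apply: zQ'; exists g.
Qed.

(** * Intersections and strictness *)

(** For each existential clause, of the two witnesses the one with larger
[rho] serves both sets. *)
Lemma confiningI Q1 Q2 : confining H t rho Q1 -> confining H t rho Q2 ->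
  confining H t rho (Q1 `&` Q2).
Proof.
move=> c1 c2; have common P1 P2 z1 z2 (A : set G) :
    confining H t rho P1 -> confining H t rho P2 ->
    (forall x, A x -> P1 (x ^ t z1)%g) -> (forall x, A x -> P2 (x ^ t z2)%g) ->
    exists z, forall x, A x -> (P1 `&` P2) (x ^ t z)%g.
  move=> cP1 cP2 A1 A2; have [z12|/ltW z21] := leP (rho z1) (rho z2).
    by exists z2 => x Ax; split; [apply: confining_conj_le (A1 x Ax) z12 | apply: A2].
  by exists z1 => x Ax; split; [apply: A1 | apply: confining_conj_le (A2 x Ax) z21].
split.
- by move=> x [/(conf_sub c1)].
- apply/seteqP; split=> [x [x1 x2]|_ [x [x1 x2] <-]].
    by exists (x^-1)%g; rewrite ?invgK//; split; apply: confiningV; rewrite ?invgK.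
  by split; apply: confiningV; rewrite ?invgK.
- by move=> z z0 _ [x [x1 x2] <-]; split; apply: confining_conj.
- move=> h Hh; have [z1 h1] := conf_absorb c1 Hh; have [z2 h2] := conf_absorb c2 Hh.
  have [||z zP] := common Q1 Q2 z1 z2 [set h] c1 c2; try by move=> _ ->.
  by exists z; apply: zP.
have [z1 _ mul1] := confining_mul_ge0 c1; have [z2 _ mul2] := confining_mul_ge0 c2.
pose A := [set (x * y)%g | x in Q1 `&` Q2 & y in Q1 `&` Q2].
have [||z zP] := common Q1 Q2 z1 z2 A c1 c2.
- by move=> _ [x [x1 _] [y [y1 _] <-]]; apply: mul1.
- by move=> _ [x [_ x2] [y [_ y2] <-]]; apply: mul2.
by exists z => _ [x Ax <-]; apply: zP.
Qed.

(** If no conjugate of [Q] by the complement is a proper subset of [Q], then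
stability makes all of them equal to [Q], and as [Q] absorbs [H] it is all of
[H]; conversely [H] is normal, so none of its conjugates is proper. *)
Lemma strictly_confiningP Q :
  strictly_confining H t rho Q <-> confining H t rho Q /\ Q <> H.
Proof.
split=> [[cQ [z [zQ Qz]]]|[cQ QH]]; split=> //.
  move=> QH; apply: Qz => x Qx; exists (x ^ (t z)^-1)%g; last by rewrite conjgKV.
  by move: Qx; rewrite QH; exact: (semi_normal hG).
apply: contrapT => nproper; apply: QH; apply/seteqP; split=> [|h Hh].
  exact: conf_sub cQ.
have [z Qhz] := conf_absorb cQ Hh.
(* The conjugate [h ^ t z] comes back to [Q]: by [conjset t Q z = Q] if
   [0 <= rho z], and by stability under [- z] otherwise. *)
have [z0|/ltW z0] := leP 0 (rho z).
  have [q Qq /conjg_inj <-//] : conjset t Q z (h ^ t z)%g.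
  apply: contrapT => hz; apply: nproper; exists z; split; first exact: (conf_stable cQ z0).
  by move=> /(_ _ Qhz).
rewrite -(conjgK (t z) h) -complementN.
by apply: confining_conj => //; rewrite raddfN oppr_ge0.
Qed.

Lemma strictly_confiningI Q1 Q2 :
  strictly_confining H t rho Q1 -> strictly_confining H t rho Q2 ->
  strictly_confining H t rho (Q1 `&` Q2).
Proof.
move=> /strictly_confiningP[c1 Q1H] /strictly_confiningP[c2 _].
apply/strictly_confiningP; split; first exact: confiningI.
move=> QH; apply: Q1H; apply/seteqP; split; first exact: conf_sub c1.
by rewrite -{1}QH; apply: subIsetl.
Qed.

(** * Joins *)

Lemma preceq_subset Q Q' : Q' `<=` Q -> preceq t rho C Q Q'.
Proof. by move=> sQ; exists 1%N => g /sQ Qg; apply: word_length_le1; left. Qed.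

Lemma preceqI Q Q1 Q2 : confining H t rho Q1 -> confining H t rho Q2 ->
    confining H t rho Q ->
  preceq t rho C Q1 Q -> preceq t rho C Q2 Q -> preceq t rho C (Q1 `&` Q2) Q.
Proof.
move=> c1 c2 cQ; have sQ := conf_sub cQ.
move=> /(preceqP c1 sQ)[z1 zQ1] /(preceqP c2 sQ)[z2 zQ2].
apply/(preceqP (confiningI c1 c2) sQ).
have conj_in P z q : conjset t Q z `<=` P -> Q q -> P (q ^ t z)%g.
  by move=> zP Qq; apply: zP; exists q.
have [z12|/ltW z21] := leP (rho z1) (rho z2); [exists z2|exists z1] => _ [q Qq <-].
  by split; [apply: confining_conj_le z12 => // |]; apply: conj_in.
by split; [|apply: confining_conj_le z21 => //]; apply: conj_in.
Qed.

Definition confining_setI (Q1 Q2 : confining_set H t rho) : confining_set H t rho :=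
  ConfiningSet (asboolT (confiningI (confining_setP Q1) (confining_setP Q2))).

Lemma conf_class_join (Q1 Q2 : confining_set H t rho) :
  is_join (conf_class C Q1) (conf_class C Q2) (conf_class C (confining_setI Q1 Q2)).
Proof.
split=> [_ [->|->]|y yub].
- by apply/conf_classP; apply: preceq_subset => g [].
- by apply/conf_classP; apply: preceq_subset => g [].
rewrite -[y]reprK -/(conf_class C (repr y)); apply/conf_classP.
apply: preceqI; try exact: confining_setP.
- by apply/conf_classP; rewrite [leRHS]reprK; apply: yub; left.
- by apply/conf_classP; rewrite [leRHS]reprK; apply: yub; right.
Qed.

(** The strict representatives of the two classes need not be [Q1] and [Q2],
but joins are unique, so the intersection of the strict representatives
defines the same class as [Q1 `&` Q2]. *)
Lemma conf_star_join (Q1 Q2 : confining_set H t rho) (x1 x2 : ConfStar H t rho C) :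
    star_class x1 = conf_class C Q1 -> star_class x2 = conf_class C Q2 ->
  exists2 x : ConfStar H t rho C,
    star_class x = conf_class C (confining_setI Q1 Q2) & is_join x1 x2 x.
Proof.
move=> x1E x2E.
have join := conf_class_join Q1 Q2.
have [P1 s1 x1E'] := asboolW (valP x1); have [P2 s2 x2E'] := asboolW (valP x2).
have strict : `[< exists2 Q : confining_set H t rho, strictly_confining H t rho Q &
    conf_class C (confining_setI Q1 Q2) = conf_class C Q >].
  apply/asboolP; exists (confining_setI P1 P2); first exact: strictly_confiningI.
  apply: is_subset1_supremums join _.
  by rewrite -x1E -x2E x1E' x2E'; apply: conf_class_join.
exists (ConfStarMk strict) => //; rewrite -x1E -x2E in join.
have [ub lub] := join; split=> [_ [->|->]|y yub]; rewrite -Order.le_val.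
- by apply: ub; left.
- by apply: ub; right.
by apply: lub => _ [->|->]; [have := yub x1 | have := yub x2];
  rewrite -Order.le_val; apply; [left | right].
Qed.

End Confining.

Theorem proposition2p9 (G : groupType) (n : nat) (H : set G)
    (t : 'rV[int]_n -> G) (R : realType) (rho : {additive 'rV[int]_n -> R})
    (a : 'I_n -> 'rV[int]_n) (C : R)
    (hG : semidirect H t)
    (hC : nontrivial rho -> admissible rho a C) :
  is_join_semilattice (ConfStar H t rho C) /\
  forall Q1 Q2 : confining_set H t rho,
    exists2 Q : confining_set H t rho, (Q : set G) = Q1 `&` Q2 &
      is_join (conf_class C Q1) (conf_class C Q2) (conf_class C Q) /\
      forall x1 x2 : ConfStar H t rho C,
        star_class x1 = conf_class C Q1 -> star_class x2 = conf_class C Q2 ->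
        exists2 x : ConfStar H t rho C,
          star_class x = conf_class C Q & is_join x1 x2 x.
Proof.
split=> [x1 x2|Q1 Q2]; last first.
  exists (confining_setI hG Q1 Q2) => //; split; first exact: conf_class_join hC Q1 Q2.
  by move=> x1 x2; apply: conf_star_join hC Q1 Q2 x1 x2.
have reprE (x : ConfStar H t rho C) : star_class x = conf_class C (repr (star_class x)).
  by rewrite /conf_class reprK.
have [x _ xjoin] := conf_star_join hG hC (reprE x1) (reprE x2).
by exists x.
Qed.
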